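(* Let $n,m\geq 1$ be integers and let $\overline{\mathbb{R}}_+=[0,\infty)$. For every real $\alpha>\frac{n}{m}$ there is a function $f:(\overline{\mathbb{R}}_+)^n\rightarrow(\overline{\mathbb{R}}_+)^m$ such that for every $x\in(\overline{\mathbb{R}}_+)^n$ and every sequence $(x_k)\subset(\overline{\mathbb{R}}_+)^n$ for which $x$ is a limit point of the set $\{x_k:k\in\mathbb{N}\}$, the restriction of $f$ to $\{x\}\cup\{x_k:k\in\mathbb{N}\}$ is not locally $C^{0,\alpha}$ in $x$ with any constant $M\in[0,\infty)$.
   Context: $|\cdot|$ is the Euclidean norm. For $A\subset\mathbb{R}^n$, $\alpha>0$ and $M\in[0,\infty)$, a function $g:A\rightarrow\mathbb{R}^m$ is called locally $C^{0,\alpha}$ in $x\in A$ with constant $M$ if there is an $r>0$ such that $|g(x)-g(x')|\leq M|x-x'|^\alpha$ for all $x'\in A$ with $|x-x'|\leq r$. A point $x$ is a limit point of a set $S$ if every neighbourhood of $x$ contains a point of $S$ different from $x$. *)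

(* Defs.v *)
From mathcomp Require Import all_boot all_order all_algebra.
From mathcomp Require Import all_classical all_reals all_analysis.

Set Implicit Arguments.
Unset Strict Implicit.
Unset Printing Implicit Defensive.

Import Order.TTheory GRing.Theory Num.Theory.
Import numFieldNormedType.Exports.

Local Open Scope classical_set_scope.
Local Open Scope ring_scope.

(* The library norm on ['rV[R]_n] is the sup norm, hence this definition. *)
Definition enorm (R : realType) (n : nat) (v : 'rV[R]_n) : R :=
  Num.sqrt (\sum_(i < n) v ord0 i ^+ 2).

Definition orthant (R : realType) (n : nat) : set 'rV[R]_n :=
  [set v | forall i, 0 <= v ord0 i].
Arguments orthant : clear implicits.

(* The restriction of [g] to [A] is locally C^(0,alpha) in [x] with constant
   [M]; intended for [A x] and [0 < alpha]. Values of [g] outside [A] are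
   irrelevant. *)
Definition locally_holder (R : realType) (n m : nat) (A : set 'rV[R]_n)
    (g : 'rV[R]_n -> 'rV[R]_m) (alpha M : R) (x : 'rV[R]_n) : Prop :=
  exists2 r : R, 0 < r &
    forall x', A x' -> enorm (x - x') <= r ->
      enorm (g x - g x') <= M * enorm (x - x') `^ alpha.

(* Main.v *)
(* It suffices to find f with |f x - f y| >= c |x - y|^beta for nearby x, y, for
   some beta strictly between n/m and alpha. Write the coordinates of x in a
   large base b, interleave their digits into one stream, and deal that stream
   out to the m coordinates of f x, where digits are read in base 2b. If the
   streams of x and y first differ at place N, then |x - y| is at most of order
   b^(-N/n), while |f x - f y| is at least of order (2b)^(-N/m), because digits
   below b in base 2b leave gaps. Taking b so large that 2b <= b^(beta m/n)
   makes these two bounds comparable. *)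
Require Import Defs.
From mathcomp Require Import all_boot all_order all_algebra.
From mathcomp Require Import all_classical all_reals all_analysis.
From mathcomp Require Import zify lra ring.

Import Order.TTheory GRing.Theory Num.Theory.
Import numFieldNormedType.Exports.

Local Open Scope classical_set_scope.
Local Open Scope ring_scope.

(** * Digit sequences below [b] read in base [2b] *)

Definition gap_code_sum (R : realType) (b : nat) (d : nat -> nat) (P : nat) : R :=
  \sum_(p < P) (d p)%:R * (b.*2)%:R ^- p.

(** The value of the infinite series. Its terms are nonnegative, so for digits below [b] the
    supremum is the limit of the partial sums, and it can be bounded by order arguments alone. *)
Definition gap_code (R : realType) (b : nat) (d : nat -> nat) : R :=
  sup (range (gap_code_sum R b d)).

Section Code.
Variables (R : realType) (b : nat) (b_gt0 : (0 < b)%N).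
Implicit Types d e : nat -> nat.

Lemma gap_code_sumS d P :
  gap_code_sum R b d P.+1 = gap_code_sum R b d P + (d P)%:R * (b.*2)%:R ^- P.
Proof. by rewrite /gap_code_sum big_ord_recr. Qed.

Lemma gap_code_sum_homo d P Q :
  (P <= Q)%N -> gap_code_sum R b d P <= gap_code_sum R b d Q.
Proof.
move=> /subnK <-; elim: (Q - P)%N => // k IHk.
by rewrite addSn gap_code_sumS (le_trans IHk)// lerDl mulr_ge0// invr_ge0 exprn_ge0.
Qed.

(** One more place replaces the slack [b] by [d P + b / (2b) = d P + 1/2], in units of [(2b)^-P],
    and this is at most [b] because [d P + 1 <= b]. *)
Lemma gap_code_sum_tail d P Q : (forall p, (d p < b)%N) -> (P <= Q)%N ->
  gap_code_sum R b d Q + b%:R * (b.*2)%:R ^- Q <=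
  gap_code_sum R b d P + b%:R * (b.*2)%:R ^- P.
Proof.
move=> ltdb /subnK <-; elim: (Q - P)%N => // k IHk.
rewrite addSn (le_trans _ IHk)// gap_code_sumS -addrA lerD2l exprSr.
rewrite invfM mulrA [X in _ + X]mulrAC -mulrDl ler_wpM2r ?invr_ge0 ?exprn_ge0//.
have bR : 0 < b%:R :> R by rewrite ltr0n.
have -> : b%:R / (b.*2)%:R = 2^-1 :> R.
  by rewrite -mul2n natrM; field; rewrite gt_eqF.
have : ((d (k + P)%N).+1)%:R <= b%:R :> R by rewrite ler_nat ltdb.
by rewrite -natr1; lra.
Qed.

Lemma gap_code_sum_le d P Q : (forall p, (d p < b)%N) ->
  gap_code_sum R b d Q <= gap_code_sum R b d P + b%:R * (b.*2)%:R ^- P.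
Proof.
move=> ltdb; have pos k : 0 <= b%:R * (b.*2)%:R ^- k :> R.
  by rewrite mulr_ge0// invr_ge0 exprn_ge0.
have [PQ|/ltnW QP] := leqP P Q.
  by rewrite (le_trans _ (gap_code_sum_tail _ _ _ ltdb PQ))// lerDl.
by rewrite (le_trans (gap_code_sum_homo d _ _ QP))// lerDl.
Qed.

Lemma gap_code_ge d P : (forall p, (d p < b)%N) -> gap_code_sum R b d P <= gap_code R b d.
Proof.
move=> ltdb; apply: ub_le_sup; last by exists P.
exists (gap_code_sum R b d 0 + b%:R * (b.*2)%:R ^- 0) => _ [Q _ <-].
exact: gap_code_sum_le.
Qed.

Lemma gap_code_le d P : (forall p, (d p < b)%N) ->
  gap_code R b d <= gap_code_sum R b d P + b%:R * (b.*2)%:R ^- P.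
Proof.
move=> ltdb; apply: ge_sup; first by exists (gap_code_sum R b d 0); exists 0%N.
by move=> _ [Q _ <-]; exact: gap_code_sum_le.
Qed.

Lemma gap_code_ge0 d : (forall p, (d p < b)%N) -> 0 <= gap_code R b d.
Proof. by move=> ltdb; have := gap_code_ge d 0 ltdb; rewrite /gap_code_sum big_ord0. Qed.

(** The larger digit at place [p] gains at least [(2b)^-p], while all later places of [d] contribute
    at most [b (2b)^-(p+1)], half of that gain. *)
Lemma gap_code_lt d e p :
  (forall q, (d q < b)%N) -> (forall q, (e q < b)%N) ->
  (forall q, (q < p)%N -> d q = e q) -> (d p < e p)%N ->
  gap_code R b d + (b.*2)%:R ^- p / 2 <= gap_code R b e.
Proof.
move=> ltdb lteb eq_de lt_de.
have bR : 0 < b%:R :> R by rewrite ltr0n.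
have := gap_code_le d p.+1 ltdb; have := gap_code_ge e p.+1 lteb.
rewrite !gap_code_sumS; have -> : gap_code_sum R b d p = gap_code_sum R b e p.
  by apply: eq_bigr => q _; rewrite eq_de.
rewrite exprSr invfM mulrCA.
have -> : b%:R / (b.*2)%:R = 2^-1 :> R.
  by rewrite -mul2n natrM; field; rewrite gt_eqF.
have : (d p)%:R * (b.*2)%:R ^- p + (b.*2)%:R ^- p <=
    (e p)%:R * (b.*2)%:R ^- p :> R.
  rewrite -[X in _ + X]mul1r -mulrDl ler_wpM2r ?invr_ge0 ?exprn_ge0//.
  by rewrite natr1 ler_nat.
by lra.
Qed.

Lemma gap_code_dist d e p :
  (forall q, (d q < b)%N) -> (forall q, (e q < b)%N) ->
  (forall q, (q < p)%N -> d q = e q) -> d p <> e p ->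
  (b.*2)%:R ^- p / 2 <= `|gap_code R b d - gap_code R b e|.
Proof.
move=> ltdb lteb eq_de ne_de.
have [lt_de|lt_ed|//] := ssrnat.ltngtP (d p) (e p).
  rewrite distrC (le_trans _ (ler_norm _))// lerBrDl.
  exact: gap_code_lt.
rewrite (le_trans _ (ler_norm _))// lerBrDl.
by apply: gap_code_lt => // q /eq_de.
Qed.

End Code.

(** * Base [b] digits of one nonnegative real *)

(* For level [0] this is the integer part modulo [b], so that digits are also
   defined, and determine nearby points, on the unbounded half line. *)
Definition digit (R : realType) (b : nat) (x : R) (k : nat) : nat :=
  Num.truncn (x * b%:R ^+ k) %% b.

Lemma truncn_divn (R : realType) (b : nat) (x : R) : (0 < b)%N -> 0 <= x ->
  (Num.truncn (x * b%:R) %/ b)%N = Num.truncn x.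
Proof.
move=> b0 x0; have bR : 0 < b%:R :> R by rewrite ltr0n.
apply/esym/truncn_def; have /andP[] := truncn_itv (mulr_ge0 x0 (ltW bR)).
set t := Num.truncn _ => le1 lt1; apply/andP; split.
  rewrite -(ler_pM2r bR) (le_trans _ le1)// -natrM ler_nat; exact: leq_divM.
by rewrite -(ltr_pM2r bR) (lt_le_trans lt1)// -natrM ler_nat ltn_ceil.
Qed.

Lemma truncn_eq_dist (R : realType) (x y : R) : 0 <= x -> 0 <= y ->
  Num.truncn x = Num.truncn y -> `|x - y| < 1.
Proof.
move=> x0 y0 e; have := truncn_itv x0; have := truncn_itv y0.
by rewrite e -natr1 ltr_norml => /andP[? ?] /andP[? ?]; apply/andP; split; lra.
Qed.

(** Induction on the level: dividing the truncation at level [K+1] by [b] leaves the truncation at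
    level [K] as quotient and the digit as remainder. *)
Lemma digit_truncn_eq (R : realType) (b : nat) (x y : R) (K : nat) :
  (1 < b)%N -> 0 <= x -> 0 <= y -> `|x - y| < 1 ->
  (forall k, (k <= K)%N -> digit R b x k = digit R b y k) ->
  Num.truncn (x * b%:R ^+ K) = Num.truncn (y * b%:R ^+ K).
Proof.
move=> b1 x0 y0 xy; have b0 := ltnW b1.
elim: K => [|K IHK] eq_xy.
  have := eq_xy 0%N isT; rewrite /digit !expr0 !mulr1 => e.
  have /andP[hx1 hx2] := truncn_itv x0; have /andP[hy1 hy2] := truncn_itv y0.
  move: xy; rewrite ltr_norml => /andP[xy1 xy2].
  (* Since [|x - y| < 1], the integer parts differ by at most 1; being congruent modulo [b >= 2],
     they are equal. *)
  have : (Num.truncn x < (Num.truncn y).+2)%N.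
    by rewrite -(ltr_nat R) -natr1; lra.
  have : (Num.truncn y < (Num.truncn x).+2)%N.
    by rewrite -(ltr_nat R) -natr1; lra.
  move: e; set s := Num.truncn x; set t := Num.truncn y => e lt1 lt2.
  have [lt_st|lt_ts|//] := ssrnat.ltngtP s t.
    have te : t = s.+1 by apply/eqP; rewrite eqn_leq lt_st -ltnS lt1.
    move: e; rewrite te -addn1 => /eqP.
    by rewrite -{1}[s]addn0 eqn_modDl mod0n modn_small.
  have se : s = t.+1 by apply/eqP; rewrite eqn_leq lt_ts -ltnS lt2.
  move: e; rewrite se -addn1 => /eqP.
  by rewrite -{2}[t]addn0 eqn_modDl mod0n modn_small.
rewrite (divn_eq (Num.truncn (x * _)) b) (divn_eq (Num.truncn (y * _)) b).
have := eq_xy K.+1 (leqnn _); rewrite /digit => ->.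
rewrite !exprSr !mulrA !truncn_divn ?mulr_ge0 ?exprn_ge0//.
by rewrite IHK// => k kK; apply: eq_xy; rewrite (leq_trans kK).
Qed.

(** Agreement at levels [0] to [K-1] only bounds the distance by [b^-(K-1)], hence the extra factor
    [b]; for [K = 0] the bound comes from [|x - y| < 1]. *)
Lemma digit_dist (R : realType) (b : nat) (x y : R) (K : nat) :
  (1 < b)%N -> 0 <= x -> 0 <= y -> `|x - y| < 1 ->
  (forall k, (k < K)%N -> digit R b x k = digit R b y k) ->
  `|x - y| * b%:R ^+ K <= b%:R.
Proof.
move=> b1 x0 y0 xy; case: K => [_|K eq_xy].
  by rewrite expr0 mulr1 (le_trans (ltW xy))// ler1n ltnW.
rewrite exprSr mulrA ler_piMl// -[X in _ * X]ger0_norm ?exprn_ge0//.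
rewrite -normrM mulrBl ltW// truncn_eq_dist ?mulr_ge0 ?exprn_ge0//.
exact: digit_truncn_eq.
Qed.

(** * Comparison of the Euclidean norm with the coordinates *)

Lemma enorm_ge0 (R : realType) (n : nat) (v : 'rV[R]_n) : 0 <= enorm v.
Proof. exact: sqrtr_ge0. Qed.

Lemma enorm_ge_coord (R : realType) (n : nat) (v : 'rV[R]_n) i :
  `|v ord0 i| <= enorm v.
Proof.
rewrite -sqrtr_sqr ler_wsqrtr// (bigD1 i)//= lerDl.
by rewrite sumr_ge0// => j _; rewrite sqr_ge0.
Qed.

Lemma enorm_le_coord (R : realType) (n : nat) (v : 'rV[R]_n) (a : R) :
  0 <= a -> (forall i, `|v ord0 i| <= a) -> enorm v <= n%:R * a.
Proof.
move=> a0 va; have na0 : 0 <= n%:R * a by rewrite mulr_ge0.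
rewrite -[leRHS]ger0_norm// -sqrtr_sqr ler_wsqrtr//.
apply: (@le_trans _ _ (\sum_(i < n) a ^+ 2)).
  by apply: ler_sum => i _; rewrite -real_normK ?num_real// lerXn2r ?nnegrE.
rewrite sumr_const card_ord -[leLHS]mulr_natl exprMn ler_wpM2r ?sqr_ge0//.
by rewrite -natrX ler_nat; nia.
Qed.

Lemma enorm_gt0 (R : realType) (n : nat) (v : 'rV[R]_n) : v != 0 -> 0 < enorm v.
Proof.
move=> v0; rewrite lt0r enorm_ge0 andbT; apply: contra v0 => /eqP e0.
apply/eqP/rowP => i; rewrite mxE; apply/eqP; rewrite -normr_le0 -e0.
exact: enorm_ge_coord.
Qed.

(** * Interleaving the digits of all coordinates and dealing them out again *)

Section DigitStream.
Variables (R : realType) (b n : nat) (b_gt1 : (1 < b)%N).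
Implicit Types x y : 'rV[R]_n.+1.

Definition digit_stream x (N : nat) : nat :=
  digit R b (x ord0 (inord (N %% n.+1))) (N %/ n.+1).

Lemma digit_streamE x (i : 'I_n.+1) k :
  digit_stream x (k * n.+1 + i) = digit R b (x ord0 i) k.
Proof.
rewrite /digit_stream modnMDl modn_small// divnMDl// divn_small// addn0.
by rewrite inord_val.
Qed.

(** The first [N] places of the stream contain every level below [N %/ n.+1] of every coordinate, so
    [digit_dist] applies to each coordinate. *)
Lemma digit_stream_dist x y N : orthant R n.+1 x -> orthant R n.+1 y ->
  enorm (x - y) < 1 ->
  (forall M, (M < N)%N -> digit_stream x M = digit_stream y M) ->
  enorm (x - y) * b%:R ^+ (N %/ n.+1) <= (n.+1 * b)%:R.
Proof.
move=> x0 y0 xy eq_xy.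
have bK : 0 < b%:R ^+ (N %/ n.+1) :> R by apply: exprn_gt0; rewrite ltr0n ltnW.
rewrite -ler_pdivlMr// natrM -mulrA enorm_le_coord ?divr_ge0 ?(ltW bK)// => i.
rewrite !mxE ler_pdivlMr// digit_dist//.
  by have := enorm_ge_coord R _ (x - y) i; rewrite !mxE => /le_lt_trans; apply.
move=> k kK; rewrite -!digit_streamE; apply: eq_xy.
rewrite (leq_trans _ (leq_divM N n.+1))//.
by rewrite (leq_trans _ (leq_mul kK (leqnn n.+1)))// mulSn addnC ltn_add2r.
Qed.

Lemma digit_stream_inj x y : orthant R n.+1 x -> orthant R n.+1 y ->
  enorm (x - y) < 1 -> digit_stream x =1 digit_stream y -> x = y.
Proof.
move=> x0 y0 xy eq_xy; apply/eqP; rewrite -subr_eq0; apply: contraT.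
move=> /enorm_gt0 d0; set d := enorm _ in xy d0.
(* Agreement everywhere would give [d * b^K <= (n+1) b] for all [K]; this [K] violates it because
   [K < b^K]. *)
have [K hK] : exists K : nat, (n.+1 * b)%:R / d < K%:R.
  by exists (Num.truncn ((n.+1 * b)%:R / d)).+1; rewrite truncnS_gt.
have := digit_stream_dist x y (K * n.+1) x0 y0 xy (fun M _ => eq_xy M).
rewrite mulnK// -/d mulrC -ler_pdivlMr// leNgt => /negP[].
by rewrite (lt_trans hK)// -natrX ltr_nat ltn_expl.
Qed.

Lemma first_difference x y : orthant R n.+1 x -> orthant R n.+1 y ->
  enorm (x - y) < 1 -> x != y ->
  exists2 N, digit_stream x N <> digit_stream y N &
    forall M, (M < N)%N -> digit_stream x M = digit_stream y M.
Proof.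
move=> x0 y0 xy ne_xy.
have exN : exists N, digit_stream x N != digit_stream y N.
  apply/not_existsP => eq_xy; move/eqP: ne_xy; apply.
  apply: digit_stream_inj => // N; apply/eqP; exact/negPn/negP/eq_xy.
have [N /eqP neN minN] := ex_minnP exN.
exists N => // M MN; apply/eqP; apply: contraTT MN => /minN.
by rewrite -leqNgt.
Qed.

Definition interleave (m : nat) x : 'rV[R]_m.+1 :=
  \row_j gap_code R b (fun p => digit_stream x (p * m.+1 + j)).

Lemma digit_stream_lt x N : (digit_stream x N < b)%N.
Proof. by rewrite ltn_pmod// ltnW. Qed.

Lemma interleave_orthant m x : orthant R m.+1 (interleave m x).
Proof.
by move=> j; rewrite mxE gap_code_ge0// ?(ltnW b_gt1)// => p; exact: digit_stream_lt.
Qed.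

(** Place [N] becomes digit [N %/ m.+1] of output coordinate [N %% m.+1]. The earlier digits of that
    coordinate come from places before [N], so [gap_code_dist] applies to this coordinate. *)
Lemma interleave_dist m x y N :
  digit_stream x N <> digit_stream y N ->
  (forall M, (M < N)%N -> digit_stream x M = digit_stream y M) ->
  (b.*2)%:R ^- (N %/ m.+1) / 2 <= enorm (interleave m x - interleave m y).
Proof.
move=> neN eqN; set j : 'I_m.+1 := inord (N %% m.+1).
have jE : j = (N %% m.+1)%N :> nat by rewrite inordK// ltn_mod.
apply: le_trans (enorm_ge_coord _ _ _ j); rewrite !mxE.
apply: gap_code_dist; rewrite ?(ltnW b_gt1)//.
- by move=> q; exact: digit_stream_lt.
- by move=> q; exact: digit_stream_lt.
- move=> q qp; apply: eqN; rewrite jE [ltnRHS](divn_eq N m.+1) ltn_add2r.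
  by rewrite ltn_mul2r.
- by rewrite jE -divn_eq.
Qed.

End DigitStream.

(** * Choice of the base and the inverse Hölder estimate *)

Lemma exists_base (R : realType) (s : R) : 1 < s ->
  exists2 b : nat, (1 < b)%N & (b.*2)%:R <= b%:R `^ s :> R.
Proof.
move=> s1; have s10 : 0 < s - 1 by rewrite subr_gt0.
(* The goal [2b <= b^s] amounts to [2 <= b^(s-1)], which holds once [b >= a]. *)
pose a : R := 2 `^ (s - 1)^-1.
exists (Num.truncn a).+2 => //; set b := _.+2.
have ab : a <= b%:R.
  by rewrite (le_trans (ltW (truncnS_gt a)))// ler_nat.
have b2 : 2 <= b%:R `^ (s - 1) :> R.
  have <- : a `^ (s - 1) = 2 by rewrite -powRrM mulVf ?gt_eqF// powRr1.
  by apply: ge0_ler_powR; rewrite ?nnegrE ?powR_ge0 ?(ltW s10).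
rewrite -(subrK 1 s) powRD ?pnatr_eq0 ?implybT// powRr1//.
by rewrite -mul2n natrM ler_wpM2r.
Qed.

Lemma exists_inverse_holder (R : realType) (n m : nat) (beta : R) :
  n.+1%:R / m.+1%:R < beta ->
  exists f : 'rV[R]_n.+1 -> 'rV[R]_m.+1,
    (forall x, orthant R m.+1 (f x)) /\
    exists2 c : R, 0 < c &
      forall x y, orthant R n.+1 x -> orthant R n.+1 y -> enorm (x - y) < 1 ->
        c * enorm (x - y) `^ beta <= enorm (f x - f y).
Proof.
move=> hbeta; have n0 : 0 < n.+1%:R :> R by rewrite ltr0n.
have m0 : 0 < m.+1%:R :> R by rewrite ltr0n.
have beta0 : 0 < beta by apply: lt_trans hbeta; rewrite divr_gt0.
(* This exponent exceeds 1 exactly because [beta] exceeds the quotient of the dimensions. *)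
have [|b b1 b2] := @exists_base R (beta * m.+1%:R / n.+1%:R).
  by rewrite ltr_pdivlMr// mul1r -ltr_pdivrMr.
have bR : 1 <= b%:R :> R by rewrite ler1n ltnW.
have B0 : 0 < b.*2%:R :> R by rewrite ltr0n double_gt0 ltnW.
have B1 : 1 <= b.*2%:R :> R by rewrite ler1n double_gt0 ltnW.
exists (interleave R b n m); split=> [x|]; first exact: interleave_orthant.
set C : R := ((n.+1 * b)%:R * b%:R) `^ beta.
have C0 : 0 < C by rewrite powR_gt0// -natrM ltr0n !muln_gt0 /= ltnW.
exists (2 * C)^-1 => [|x y x0 y0 xy]; first by rewrite invr_gt0 mulr_gt0.
have [->|ne_xy] := eqVneq x y.
  rewrite [y - y]subrr; have -> : enorm (0 : 'rV[R]_n.+1) = 0.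
    by rewrite /enorm big1 ?sqrtr0// => i _; rewrite mxE expr0n.
  (* Positivity of [beta] matters here: the power of 0 with exponent 0 would be 1. *)
  by rewrite powR0 ?gt_eqF// mulr0 enorm_ge0.
have [N neN eqN] := first_difference R b n b1 x y x0 y0 xy ne_xy.
apply: le_trans (interleave_dist R b n b1 m x y N neN eqN).
have := digit_stream_dist R b n b1 x y N x0 y0 xy eqN.
set d := enorm _; have d0 : 0 <= d by exact: enorm_ge0.
move=> dK.
(* Passing from the integer quotient to the real one costs a second factor [b], since the real
   quotient is below the integer one plus 1. *)
have dN : d * b%:R `^ (N%:R / n.+1%:R) <= (n.+1 * b)%:R * b%:R.
  rewrite (le_trans _ (ler_wpM2r (ler0n R b) dK))// -mulrA -exprSr.
  rewrite ler_wpM2l// -powR_mulrn// ler_powR// ler_pdivrMr// -natrM ler_nat.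
  by rewrite ltnW// ltn_ceil.
(* Rounding down goes the right way here, and [2b <= b^(beta (m+1)/(n+1))] turns [(2b)^(N/(m+1))]
   into at most [(b^(N/(n+1)))^beta]. *)
have : d `^ beta * b.*2%:R ^+ (N %/ m.+1) <= C.
  apply: (@le_trans _ _ ((d * b%:R `^ (N%:R / n.+1%:R)) `^ beta)); last first.
    by apply: ge0_ler_powR; rewrite ?nnegrE ?mulr_ge0 ?powR_ge0// ltW.
  rewrite powRM ?powR_ge0// ler_wpM2l ?powR_ge0//.
  apply: (@le_trans _ _ (b.*2%:R `^ (N%:R / m.+1%:R))).
    rewrite -powR_mulrn// ler_powR// ler_pdivlMr// -natrM ler_nat.
    exact: leq_divM.
  apply: (@le_trans _ _ ((b%:R `^ (beta * m.+1%:R / n.+1%:R)) `^ (N%:R / m.+1%:R))).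
    by apply: ge0_ler_powR; rewrite ?nnegrE ?powR_ge0 ?divr_ge0.
  rewrite -!powRrM; rewrite le_eqVlt; apply/orP; left; apply/eqP; congr (_ `^ _); field.
  by rewrite !gt_eqF.
rewrite -ler_pdivlMr ?exprn_gt0// => h.
have c0 : 0 <= (2 * C)^-1 by rewrite invr_ge0 mulr_ge0// ltW.
rewrite (le_trans (ler_wpM2l c0 h))// le_eqVlt; apply/orP; left; apply/eqP.
by field; rewrite !gt_eqF ?exprn_gt0.
Qed.

(** * Limit points and the failure of Hölder continuity *)

Lemma limit_point_enorm (R : realType) (n : nat) (S : set 'rV[R]_n.+1) x (r : R) :
  limit_point S x -> 0 < r ->
  exists y, [/\ y != x, S y & enorm (x - y) < r].
Proof.
move=> Sx r0.
(* Library balls are for the sup norm. The Euclidean norm is at most [n+1] times larger, and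
   dividing by [n+2] keeps the inequality strict. *)
have e0 : 0 < r / n.+2%:R by rewrite divr_gt0// ltr0n.
have [y [yx Sy [_ xy]]] := Sx _ (nbhsx_ballx x _ e0).
exists y; split=> //.
apply: (@le_lt_trans _ _ (n.+1%:R * (r / n.+2%:R))).
  apply: enorm_le_coord => [|i]; first exact: ltW.
  by rewrite !mxE ltW//; have := xy ord0 i.
by rewrite mulrCA gtr_pMr// ltr_pdivrMr ?ltr0n// mul1r ltr_nat.
Qed.

Theorem mainTheorem3 (R : realType) (n m : nat) (hn : (1 <= n)%N)
    (hm : (1 <= m)%N) (alpha : R) (halpha : n%:R / m%:R < alpha) :
  exists f : 'rV[R]_n -> 'rV[R]_m,
    (forall x, orthant R n x -> orthant R m (f x)) /\
    forall (x : 'rV[R]_n) (x_ : nat -> 'rV[R]_n),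
      orthant R n x ->
      (forall k, orthant R n (x_ k)) ->
      limit_point (range x_) x ->
      forall M : R, 0 <= M ->
        ~ locally_holder (x |` range x_) f alpha M x.
Proof.
case: n hn halpha => // n _; case: m hm => // m _ halpha.
set q := n.+1%:R / m.+1%:R in halpha; pose beta := (q + alpha) / 2.
have beta_gt : q < beta by rewrite /beta; lra.
have ab0 : 0 < alpha - beta by rewrite /beta; lra.
have [f [f0 [c c0 hf]]] := exists_inverse_holder R n m beta beta_gt.
exists f; split=> [x _ //|x x_ x0 x_0 xlim M M0 [r r0 hr]].
have M1 : 0 < M + 1 by rewrite ltr_wpDl.
(* Below this distance [t^(alpha - beta) < c / (M + 1)]; using [M + 1] covers the case [M = 0]. *)
pose d := (c / (M + 1)) `^ (alpha - beta)^-1.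
have d0 : 0 < d by rewrite powR_gt0// divr_gt0.
have [|y [yx [k _ ky] xy]] :=
  limit_point_enorm R n _ x (Num.min (Num.min r 1) d) xlim.
  by rewrite !lt_min r0 ltr01 d0.
move: xy; rewrite !lt_min => /andP[/andP[xyr xy1] xyd].
have y0 : orthant R n.+1 y by rewrite -ky.
have := le_trans (hf x y x0 y0 xy1) (hr y (or_intror (ex_intro2 _ _ k I ky)) (ltW xyr)).
have t0 : 0 < enorm (x - y) by rewrite enorm_gt0// subr_eq0 eq_sym.
set t := enorm (x - y) in xyd t0 *.
(* The two estimates give [c t^beta <= M t^alpha]. Cancelling [t^beta] leaves
   [c <= M t^(alpha - beta)], against the choice of [d]. *)
rewrite -(subrK beta alpha) powRD ?(gt_eqF t0) ?implybT// mulrA.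
rewrite ler_pM2r ?powR_gt0// leNgt => /negP; apply.
have : t `^ (alpha - beta) < c / (M + 1).
  have -> : c / (M + 1) = d `^ (alpha - beta).
    by rewrite -powRrM mulVf ?gt_eqF// powRr1// divr_ge0// ltW.
  by apply: gt0_ltr_powR; rewrite ?nnegrE// ltW.
rewrite ltr_pdivlMr// mulrC => /(le_lt_trans _); apply.
by rewrite ler_wpM2r ?powR_ge0// lerDl.
Qed.
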